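(* For $n\in\mathbb{N}$, let $F(n)=\#\{(x,y)\in\mathbb{Z}^2 : x^2+xy+y^2\le n\}$ be the number of lattice points contained in the elliptical region $x^2+xy+y^2\le n$. Then $$F(n) = 6\,\mathcal{N}_{n,0,0,1,3}+1.$$
   Context: $\mathbb{N}$ denotes the set of positive integers and $\lfloor\cdot\rfloor$ the floor function. For $n,m\in\mathbb{N}$, $r\in\mathbb{Z}$ and $\alpha,\nu\in\mathbb{R}$, define $$\mathcal{N}_{n,\alpha,\nu,r,m}=\#\left\{k\in\mathbb{Z} : 1\le k\le n,\ \left\lfloor\frac{n-\nu}{k}+\alpha\right\rfloor\equiv r \pmod m\right\}.$$ *)

(* Defs.v *)
From HB Require Import structures.
From mathcomp Require Import all_boot all_order all_algebra.
From mathcomp Require Import finmap.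
From mathcomp Require Import all_classical all_reals.
Set Implicit Arguments.
Unset Strict Implicit.
Unset Printing Implicit Defensive.
Import Order.TTheory GRing.Theory Num.Theory.
Local Open Scope classical_set_scope.
Local Open Scope ring_scope.

(* [fset_set A] is the finite set with the elements of [A] when [A] is finite,
   and the empty one otherwise; so [#|` fset_set A|] is the number of elements
   of [A] whenever [A] is finite. *)

Definition floor_residue_count (R : realType) (n : nat) (alpha nu : R)
    (r : int) (m : nat) : nat :=
  #|` fset_set [set k : int | 1 <= k <= n%:Z /\
        (Num.floor ((n%:R - nu) / k%:~R + alpha) = r %[mod m%:Z])%Z ] |.

Definition ellipse_count (n : nat) : nat :=
  #|` fset_set [set p : int * int |
        p.1 ^+ 2 + p.1 * p.2 + p.2 ^+ 2 <= n%:Z ] |.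

(* Main.v *)
Require Import Defs.
From mathcomp Require Import all_boot all_order all_algebra all_field.
From mathcomp Require Import finmap.
From mathcomp Require Import all_classical all_reals.
From mathcomp Require Import ring zify.

(* Let chi be the nontrivial character modulo 3. The number r(m) of
   representations of m > 0 by x^2 + xy + y^2, the norm form of the Eisenstein
   integers, is 6 g(m) with g(m) the sum of chi(d) over the divisors d of m.
   Both r and g satisfy
     f(p m) = (1 + chi(p)) f(m) - chi(p) f(m / p)    (f(m / p) = 0 if p does not divide m)
   for p prime: for g this is multiplicativity of chi, and for r it says that an
   element of norm p m is divisible by p if p = 2 mod 3, by an element of norm 3
   if p = 3, and by an element w of norm p or its conjugate if p = 1 mod 3, both
   being the case exactly when p divides it. Finally the sum of g(m) over m <= n
   is the sum over k <= n of the partial sums of chi up to n / k, and such a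
   partial sum is 1 or 0 according as n / k is 1 modulo 3 or not. *)

Set Implicit Arguments.
Unset Strict Implicit.
Unset Printing Implicit Defensive.
Import Order.TTheory GRing.Theory Num.Theory.
Local Open Scope fset_scope.
Local Open Scope ring_scope.

(** * Arithmetic of the Eisenstein integers *)

Definition enorm (z : int * int) : int := z.1 ^+ 2 + z.1 * z.2 + z.2 ^+ 2.

(* [(a, b)] stands for [a - b * omega], where [omega ^ 2 + omega + 1 = 0]. *)
Definition emul (z w : int * int) : int * int :=
  (z.1 * w.1 - z.2 * w.2, z.1 * w.2 + z.2 * w.1 + z.2 * w.2).

Definition econj (z : int * int) : int * int := (z.1 + z.2, - z.2).

Lemma enorm_mul z w : enorm (emul z w) = enorm z * enorm w.
Proof. by case: z w => [a b] [c d]; rewrite /enorm /emul /=; ring. Qed.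

Lemma enorm_conj z : enorm (econj z) = enorm z.
Proof. by case: z => [a b]; rewrite /enorm /econj /=; ring. Qed.

Lemma econjK : involutive econj.
Proof. by case=> [a b]; rewrite /econj /=; congr pair; ring. Qed.

(** This is z * conj z = [enorm z] combined with associativity; it serves to divide by [z]. *)
Lemma emul_conjK z w :
  emul z (emul (econj z) w) = (enorm z * w.1, enorm z * w.2).
Proof.
by case: z w => [a b] [c d]; rewrite /enorm /emul /econj /=; congr pair; ring.
Qed.

Lemma emul_scale z k w :
  emul z (k * w.1, k * w.2) = (k * (emul z w).1, k * (emul z w).2).
Proof. by case: z w => [a b] [c d]; rewrite /emul /=; congr pair; ring. Qed.

Lemma scale_inj (k : int) : k != 0 ->
  injective (fun z : int * int => (k * z.1, k * z.2)).
Proof. by move=> k0 [a b] [c d] /= [/(mulfI k0)-> /(mulfI k0)->]. Qed.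

Lemma emul_inj z : enorm z != 0 -> injective (emul z).
Proof.
move=> z0 u v /(congr1 (emul (econj z))).
rewrite -[z in emul _ (emul z _) = _]econjK -[z in _ = emul _ (emul z _)]econjK.
by rewrite !emul_conjK !enorm_conj; apply: (scale_inj z0).
Qed.

Lemma enorm_scale (k : int) z : enorm (k * z.1, k * z.2) = k ^+ 2 * enorm z.
Proof. by case: z => [a b]; rewrite /enorm /=; ring. Qed.

(** Since 4 (a^2 + ab + b^2) = 3 a^2 + (2b + a)^2 and |a| <= a^2, one gets 3 |a| <= 4 n. This crude
    bound suffices for finiteness. *)
Lemma enorm_bound z (n : nat) : enorm z <= n%:Z ->
  (`|z.1| <= 2 * n)%N /\ (`|z.2| <= 2 * n)%N.
Proof.
case: z => a b; rewrite /enorm /= => le_n.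
have sq (x : int) : `|x| <= x ^+ 2 by case: (lerP 0 x) => ?; nia.
have ha := sq a; have hb := sq b.
have sa := sqr_ge0 (2 * b + a); have sb := sqr_ge0 (2 * a + b).
split; nia.
Qed.

Lemma enorm_ge0 z : 0 <= enorm z.
Proof.
case: z => a b; rewrite /enorm /=.
have sa := sqr_ge0 (2 * b + a); have sb := sqr_ge0 (2 * a + b); nia.
Qed.

(** * Lattice points of bounded and of given norm *)

Lemma in_fset_sep (K : choiceType) (A : {fset K}) (P : pred K) x :
  (x \in [fset z in A | P z]) = (x \in A) && P x.
Proof. by rewrite !inE. Qed.

Lemma cardfs_imfset (K K' : choiceType) (f : K -> K') (A : {fset K}) :
  injective f -> #|` f @` A| = #|` A|.
Proof. exact: card_imfset. Qed.

Lemma mem_imfsetP (K K' : choiceType) (f : K -> K') (A : {fset K}) y :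
  reflect (exists2 x, x \in A & y = f x) (y \in f @` A).
Proof. exact: imfsetP. Qed.

(** Filtering the square [-2n, 2n]^2, large enough by [enorm_bound], makes the set explicitly
    finite. *)
Definition ball (n : nat) : {fset int * int} :=
  let s := [seq i%:Z - (2 * n)%:Z | i <- iota 0 (4 * n + 1)] in
  [fset z in [seq (x, y) | x <- s, y <- s] | enorm z <= n%:Z].

Lemma in_ball n z : (z \in ball n) = (enorm z <= n%:Z).
Proof.
rewrite !inE andb_idl // => /enorm_bound [ha hb].
case: z ha hb => a b /= ha hb.
apply/allpairsP; exists (a, b); split=> //=; apply/mapP.
  by exists (absz (a + (2 * n)%:Z)); rewrite ?mem_iota; lia.
by exists (absz (b + (2 * n)%:Z)); rewrite ?mem_iota; lia.
Qed.

Definition circle (n : nat) : {fset int * int} :=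
  locked [fset z in ball n | enorm z == n%:Z].

Lemma in_circle n z : (z \in circle n) = (enorm z == n%:Z).
Proof. by rewrite /circle -lock in_fset_sep in_ball andb_idl // => /eqP ->. Qed.

(** Multiplication by p multiplies norms by p^2, so it maps norm m / p bijectively onto the
    multiples of p of norm p m; and p^2 c = p m forces p to divide m. *)
Lemma card_scale (p m : nat) : (0 < p)%N ->
  #|` [fset z in circle (p * m) | (p %| z.1)%Z && (p %| z.2)%Z]| =
  (if (p %| m)%N then #|` circle (m %/ p)| else 0%N).
Proof.
move=> p0; have p0Z : p%:Z != 0 by lia.
case: ifPn => [/dvdnP[k ->]|pNm].
  rewrite mulnK // -(cardfs_imfset (circle k) (scale_inj p0Z)); congr (#|` _|).
  apply/fsetP => -[a b]; rewrite in_fset_sep in_circle; apply/idP/mem_imfsetP.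
    case/andP=> /eqP E /andP[/dvdzP[c /= Ec] /dvdzP[d /= Ed]].
    exists (c, d); last by rewrite /= Ec Ed; congr pair; ring.
    rewrite in_circle; apply/eqP.
    have : p%:Z ^+ 2 * enorm (c, d) = p%:Z ^+ 2 * k%:Z.
      rewrite -enorm_scale /= [p%:Z * c]mulrC [p%:Z * d]mulrC -Ec -Ed E.
      by rewrite !PoszM; ring.
    by apply: mulfI; rewrite expf_neq0.
  case=> z; rewrite in_circle => /eqP zk ->; rewrite !dvdz_mulr // enorm_scale zk.
  have -> : p%:Z ^+ 2 * k%:Z = (p * (k * p))%N by rewrite !PoszM; ring.
  by rewrite eqxx.
apply/eqP; rewrite cardfs_eq0; apply/eqP/fsetP => -[a b].
rewrite in_fset0 in_fset_sep in_circle /=; apply/negP.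
case/andP=> /eqP E /andP[/dvdzP[c /= Ec] /dvdzP[d /= Ed]].
case/negP: pNm; have : (p%:Z %| m%:Z)%Z; last by [].
apply/dvdzP; exists (enorm (c, d)); apply: (mulfI p0Z).
rewrite -PoszM -E Ec Ed /enorm /=; ring.
Qed.

(** These are the six units. *)
Lemma card_circle1 : #|` circle 1| = 6%N.
Proof.
have -> : circle 1 = [fset z in [:: (1, 0); (-1, 0); (0, 1); (0, -1);
    (1, -1); (-1, 1)] : seq (int * int)].
  apply/fsetP => -[a b]; rewrite in_circle !inE /= !xpair_eqE.
  apply/eqP/idP; last first.
    by move=> H; do ![case/orP: H => H] => //; case/andP: H => /eqP-> /eqP->.
  move=> E; have [] := @enorm_bound (a, b) 1; first by rewrite E.
  by rewrite /enorm /= in E *; nia.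
by rewrite card_fseq.
Qed.

Lemma circle0 : circle 0 = [fset (0, 0)].
Proof.
apply/fsetP => -[a b]; rewrite in_circle inE xpair_eqE.
apply/eqP/andP => [E|[/eqP-> /eqP->]] //.
by have [] := @enorm_bound (a, b) 0; [rewrite E | rewrite !muln0 /=; lia].
Qed.

Lemma ballS n : #|` ball n.+1| = (#|` ball n| + #|` circle n.+1|)%N.
Proof.
rewrite -cardfsUI [X in (_ + X)%N](_ : _ = 0%N) ?addn0.
  congr (#|` _|); apply/fsetP => z; rewrite in_fsetU !in_ball in_circle; lia.
apply/eqP; rewrite cardfs_eq0; apply/eqP/fsetP => z.
rewrite in_fsetI in_ball in_circle in_fset0; lia.
Qed.

(** The summand 1 is the origin, the only point of norm 0. *)
Lemma card_ball n :
  #|` ball n| = (\sum_(1 <= m < n.+1) #|` circle m| + 1)%N.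
Proof.
elim: n => [|n IHn]; last by rewrite ballS IHn [in RHS]big_nat_recr //= addnAC.
rewrite big_geq //= -(cardfs1 (0 : int, 0 : int)) -circle0; congr (#|` _|).
by apply/fsetP => z; rewrite in_ball in_circle eq_le enorm_ge0 andbT.
Qed.

Lemma ellipse_countE n : ellipse_count n = #|` ball n|.
Proof.
rewrite /ellipse_count; congr (#|` _|).
rewrite -[RHS]set_fsetK; congr fset_set.
by apply/seteqP; split => z /=; rewrite in_ball.
Qed.

(** * The norm form modulo a prime, and primes that are norms *)

Lemma enorm_Fp (F : comNzRingType) a b :
  (enorm (a, b))%:~R = a%:~R ^+ 2 + a%:~R * b%:~R + b%:~R ^+ 2 :> F.
Proof. by rewrite /enorm /= !rmorphD !rmorphXn !rmorphM. Qed.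

(* Modulo p, x^3 = y^3, and cubing is injective because 3 is prime to p - 1. *)
Lemma dvdz_enorm_inert p z : prime p -> (p %% 3 = 2)%N ->
  (p %| enorm z)%Z = (p %| z.1)%Z && (p %| z.2)%Z.
Proof.
case: z => a b p_pr p3 /=; have chp := pchar_Fp p_pr.
apply/idP/andP => [|[/dvdzP[c ->] /dvdzP[d ->]]]; last first.
  by apply/dvdzP; exists (p%:Z * enorm (c, d)); rewrite /enorm /=; ring.
rewrite !(dvdz_pcharf chp) enorm_Fp => /eqP.
move: (a%:~R) (b%:~R) => x y E.
have x3y3 : x ^+ 3 = y ^+ 3.
  apply/eqP; rewrite -subr_eq0; apply/eqP.
  by transitivity ((x - y) * (x ^+ 2 + x * y + y ^+ 2)); [ring|rewrite E mulr0].
have pE : p = (3 * (p %/ 3) + 2)%N by rewrite {1}(divn_eq p 3) p3 mulnC.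
(* Fermat's u^p = u. As x^3 = y^3, the same factor [c] gives x = c x^2 and y = c y^2, whence x = y
   if both are nonzero. *)
have xp (u : 'F_p) : u = u ^+ 3 ^+ (p %/ 3) * u ^+ 2.
  by rewrite -exprM -exprD -pE -[LHS]expf_card card_Fp.
set c := x ^+ 3 ^+ (p %/ 3).
have xE : x = c * x ^+ 2 by rewrite /c -xp.
have yE : y = c * y ^+ 2 by rewrite /c x3y3 -xp.
have n3 : 3 != 0 :> 'F_p.
  rewrite -(dvdn_pcharf chp); apply/negP; rewrite dvdn_prime2 // => /eqP pE3.
  by rewrite pE3 in p3.
have [x0|x0] := eqVneq x 0.
  split=> //; move/eqP: E.
  by rewrite x0 expr0n mul0r !add0r sqrf_eq0.
have [y0|y0] := eqVneq y 0.
  split=> //; move/eqP: E.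
  by rewrite y0 expr0n mulr0 !addr0 sqrf_eq0 (negPf x0).
have xy : x = y.
  apply: (mulfI (mulf_neq0 x0 y0)).
  transitivity (y * x ^+ 2); first by ring.
  by rewrite {1}yE -mulrA [y ^+ 2 * _]mulrC mulrA -xE; ring.
have : 3 * x ^+ 2 = 0 by rewrite -[RHS]E -xy; ring.
by move/eqP; rewrite mulf_eq0 (negPf n3) sqrf_eq0 (negPf x0).
Qed.

(** With p = 3k + 1, the polynomial X^k - 1 has at most k roots among the 3k nonzero elements; for x
    outside them, t = x^k is a cube root of 1 other than 1. *)
Lemma Fp_cube_root1 p : prime p -> (p %% 3 = 1)%N ->
  exists t : 'F_p, t ^+ 2 + t + 1 = 0.
Proof.
move=> p_pr p3; set k := (p %/ 3)%N.
have pE : p = (k * 3).+1 by rewrite {1}(divn_eq p 3) p3 addn1.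
have k_gt0 : (0 < k)%N by have := prime_gt1 p_pr; lia.
case: (pickP [pred x : 'F_p | (x != 0) && (x ^+ k != 1)]) => /= [x|all1].
  case/andP=> x0 xk; exists (x ^+ k).
  have /eqP : (x ^+ k - 1) * ((x ^+ k) ^+ 2 + x ^+ k + 1) = 0.
    transitivity ((x ^+ k) ^+ 3 - 1); first by ring.
    have : x * x ^+ (k * 3) = x * 1.
      by rewrite mulr1 -exprS -pE -[RHS]expf_card card_Fp.
    by move/(mulfI x0); rewrite exprM => ->; rewrite subrr.
  by rewrite mulf_eq0 subr_eq0 (negPf xk) => /eqP.
have X0 : 'X^k - 1%:P != 0 :> {poly 'F_p} by rewrite -size_poly_gt0 size_XnsubC.
have := @max_poly_roots _ _ (enum [pred x : 'F_p | x != 0]) X0.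
rewrite size_XnsubC // enum_uniq -cardE.
have -> : #|[pred x : 'F_p | x != 0]| = (k * 3)%N.
  transitivity #|'F_p|.-1; last by rewrite card_Fp //; lia.
  by rewrite -(cardC1 (0 : 'F_p)); apply: eq_card => x; rewrite !inE.
move=> H; suff : (k * 3 < k.+1)%N by lia.
apply: H => //; apply/allP => x; rewrite mem_enum inE => x0.
rewrite rootE !hornerE subr_eq0; have := all1 x.
by move=> /=; rewrite x0 /= => /negbFE.
Qed.

Lemma nat_sqrt n : exists s, (s ^ 2 <= n < s.+1 ^ 2)%N.
Proof.
elim: n => [|n [s IHs]]; first by exists 0%N.
have [lt|ge] := ltnP n.+1 (s.+1 ^ 2); first by exists s; lia.
by exists s.+1; rewrite ge /=; move: IHs ge; rewrite !expnS !expn0; nia.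
Qed.

Lemma enorm_eq0 z : (enorm z == 0) = (z == (0, 0)).
Proof.
apply/eqP/eqP => [E|-> //]; case: z E => a b E.
have [] := @enorm_bound (a, b) 0; first by rewrite E.
by rewrite !muln0 /= => ? ?; congr pair; lia.
Qed.

(* Thue: by the pigeonhole principle a = t b mod p with |a|, |b| < sqrt p, so the
   norm of (a, b) is p or 2p, and a norm that is even is divisible by 4. *)
Lemma prime_enorm p : prime p -> (p %% 3 = 1)%N -> exists z, enorm z = p%:Z.
Proof.
move=> p_pr p3; have [t tE] := Fp_cube_root1 p_pr p3.
have chp := pchar_Fp p_pr.
have [s /andP[s2p p_lt]] := nat_sqrt p.
(* A prime is not a square; hence s^2 < p, and the norm, at most 3 s^2, stays strictly below 3p. *)
have s2_neq : (s ^ 2 != p)%N.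
  apply/eqP => E; have p_gt1 := prime_gt1 p_pr.
  have [_ /(_ s)] := primeP p_pr; rewrite -{1}E dvdn_exp // => /(_ isT).
  by case/orP=> /eqP sE; move: E p_gt1; rewrite !expnS expn0; nia.
pose f (ij : 'I_s.+1 * 'I_s.+1) : 'F_p := (ij.1)%:R - t * (ij.2)%:R.
have : ~~ injectiveb f.
  apply/negP => /injectiveP/leq_card.
  by rewrite card_Fp // card_prod !card_ord // leqNgt mulnn p_lt.
case/injectivePn=> -[i j] [[i' j'] neq /eqP]; rewrite /f /= => /eqP fE.
pose a := i%:Z - i'%:Z; pose b := j%:Z - j'%:Z.
have abE : a%:~R = t * b%:~R :> 'F_p.
  rewrite /a /b !rmorphB /= -!pmulrn.
  have -> : i%:R = i'%:R - t * j'%:R + t * j%:R :> 'F_p by rewrite -fE; ring.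
  by ring.
have : (p %| enorm (a, b))%Z.
  rewrite (dvdz_pcharf chp) enorm_Fp abE; apply/eqP.
  by transitivity (b%:~R ^+ 2 * (t ^+ 2 + t + 1)); [ring | rewrite tE mulr0].
case/dvdzP=> c cE.
have n0 : enorm (a, b) != 0.
  rewrite enorm_eq0; apply: contra neq => /eqP[/eqP + /eqP].
  rewrite /a /b !subr_eq0 => /eqP[Ei] /eqP[Ej].
  by rewrite xpair_eqE -!val_eqE /= Ei Ej !eqxx.
have npos := enorm_ge0 (a, b).
have lt3 : enorm (a, b) < 3 * p%:Z.
  have hi := ltn_ord i; have hi' := ltn_ord i'.
  have hj := ltn_ord j; have hj' := ltn_ord j'.
  have s2 : s%:Z * s%:Z < p%:Z by nia.
  rewrite /enorm /=.
  have ha : - s%:Z <= a <= s%:Z by lia.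
  have hb : - s%:Z <= b <= s%:Z by lia.
  nia.
have [c1|c2] : c = 1 \/ c = 2.
  by have := prime_gt0 p_pr; nia.
  by exists (a, b); rewrite cE c1 mul1r.
exfalso.
have p_odd : ~~ (2 %| p)%N.
  by apply/negP; rewrite dvdn_prime2 // => /eqP p2; rewrite -p2 in p3.
have [a' [r [Ea hr]]] : exists a' r : int, a = 2 * a' + r /\ (r = 0 \/ r = 1).
  by exists (a %/ 2)%Z, (a %% 2)%Z; lia.
have [b' [r' [Eb hr']]] : exists b' r : int, b = 2 * b' + r /\ (r = 0 \/ r = 1).
  by exists (b %/ 2)%Z, (b %% 2)%Z; lia.
move: cE; rewrite /enorm c2 Ea Eb /=.
set A := a' ^+ 2 + a' * b' + b' ^+ 2.
have -> : (2 * a' + r) ^+ 2 + (2 * a' + r) * (2 * b' + r') + (2 * b' + r') ^+ 2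
  = 4 * A + 2 * (2 * a' * r + a' * r' + b' * r + 2 * b' * r') 
    + (r ^+ 2 + r * r' + r' ^+ 2) by rewrite /A; ring.
by case: hr hr' => [->|->] [->|->]; rewrite ?mulr0 ?mulr1 ?expr0n ?expr1n; lia.
Qed.

(** * Recurrence for the number of points of norm p m *)

(** Let v = conj w * z. Its norm is divisible by p, so once p divides the second coordinate it
    divides the square of the first. Then v = p u, and w v = p z gives z = w u. *)
Lemma emul_dvd p w z : prime p -> enorm w = p%:Z -> (p %| enorm z)%Z ->
  (p %| (emul (econj w) z).2)%Z -> exists u, z = emul w u.
Proof.
move=> p_pr wE pz; have p0 : p%:Z != 0 by have := prime_gt0 p_pr; lia.
set v := emul _ _ => pv2.
have : (p %| enorm v)%Z by rewrite enorm_mul enorm_conj wE dvdz_mulr.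
have pv1 : (p %| enorm v)%Z -> (p %| v.1)%Z.
  have chp := pchar_Fp p_pr; move: pv2; case: v => x y /=.
  rewrite !(dvdz_pcharf chp) enorm_Fp => /eqP->.
  by rewrite mulr0 expr0n !addr0 sqrf_eq0.
move/pv1/dvdzP=> [c cE]; have [d dE] := dvdzP pv2.
exists (c, d); apply: (scale_inj p0); rewrite -[in LHS]wE -emul_conjK -/v.
have -> : v = (p%:Z * (c, d).1, p%:Z * (c, d).2).
  by rewrite [LHS]surjective_pairing cE dE; congr pair; rewrite mulrC.
exact: emul_scale.
Qed.

Lemma card_emul p w m : prime p -> enorm w = p%:Z ->
  #|` [fset z in circle (p * m) | (p %| (emul (econj w) z).2)%Z]| =
  #|` circle m|.
Proof.
move=> p_pr wE; have p0 : p%:Z != 0 by have := prime_gt0 p_pr; lia.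
have w0 : enorm w != 0 by rewrite wE.
rewrite -(cardfs_imfset (circle m) (emul_inj w0)); congr (#|` _|).
apply/fsetP => z; rewrite in_fset_sep in_circle; apply/idP/mem_imfsetP.
  case/andP=> /eqP zE pz; have [|u uE] := emul_dvd p_pr wE _ pz.
    by rewrite zE PoszM dvdz_mulr.
  exists u => //; rewrite in_circle; apply/eqP/(mulfI w0).
  by rewrite -enorm_mul -uE zE wE PoszM.
case=> u; rewrite in_circle => /eqP uE ->.
rewrite enorm_mul wE uE PoszM eqxx -[w in emul w u]econjK emul_conjK /=.
by rewrite enorm_conj wE dvdz_mulr.
Qed.

(** Here w = (1, 1) has norm 3, and its divisibility criterion 3 | y - x always holds because (y -
    x)^2 = 3m - 3xy. *)
Lemma card_circle_ramified m : #|` circle (3 * m)| = #|` circle m|.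
Proof.
rewrite -(@card_emul 3 (1, 1) m) //; congr (#|` _|); apply/fsetP => -[x y].
rewrite in_fset_sep in_circle andb_idr // => /eqP E.
suff : (3 %| y - x)%Z by congr (_ %| _)%Z; rewrite /emul /econj /=; ring.
rewrite (dvdz_pcharf (pchar_Fp (isT : prime 3))) -sqrf_eq0 -rmorphXn.
rewrite -(dvdz_pcharf (pchar_Fp (isT : prime 3))).
have -> : (y - x) ^+ 2 = (m%:Z - x * y) * 3.
  by rewrite mulrBl [m%:Z * 3]mulrC -PoszM -E /enorm /=; ring.
exact: dvdz_mull.
Qed.

Lemma card_circle_inert p m : prime p -> (p %% 3 = 2)%N ->
  #|` circle (p * m)| = (if (p %| m)%N then #|` circle (m %/ p)| else 0%N).
Proof.
move=> p_pr p3; rewrite -(card_scale _ (prime_gt0 p_pr)); congr (#|` _|).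
apply/fsetP => z; rewrite in_fset_sep in_circle andb_idr // => /eqP E.
by rewrite -dvdz_enorm_inert // E PoszM dvdz_mulr.
Qed.

Lemma card_circle_split p m : prime p -> (p %% 3 = 1)%N ->
  (#|` circle (p * m)| +
     (if (p %| m)%N then #|` circle (m %/ p)| else 0))%N = (2 * #|` circle m|)%N.
Proof.
move=> p_pr p3; have [w wE] := prime_enorm p_pr p3.
have chp := pchar_Fp p_pr.
have cwE : enorm (econj w) = p%:Z by rewrite enorm_conj.
rewrite -(card_scale _ (prime_gt0 p_pr)) mul2n -addnn.
(* Inclusion-exclusion for the multiples of w and those of conj w. *)
rewrite -{1}(card_emul m p_pr wE) -(card_emul m p_pr cwE).
rewrite econjK -[RHS]cardfsUI; congr (_ + _)%N; congr (#|` _|); apply/fsetP => -[x y].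
  rewrite in_fsetU !in_fset_sep in_circle -andb_orr andb_idr // => /eqP E.
  have : (p %| enorm (x, y))%Z by rewrite E PoszM dvdz_mulr.
  move=> {E}; have : (p %| enorm w)%Z by rewrite wE.
  case: {wE cwE} w => a b; rewrite /emul /econj /= !(dvdz_pcharf chp) !enorm_Fp.
  rewrite -mulf_eq0 !rmorphD !rmorphM /= rmorphD rmorphN /=.
  move: (a%:~R) (b%:~R) (x%:~R) (y%:~R) => {}a {}b {}x {}y /eqP ab /eqP xy.
  (* The product of the two second coordinates is a combination of the norms of w and z, so p
     divides one of them. *)
  apply/eqP; transitivity (y ^+ 2 * (a ^+ 2 + a * b + b ^+ 2)
     - b ^+ 2 * (x ^+ 2 + x * y + y ^+ 2)); first by ring.
  by rewrite ab xy !mulr0 subrr.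
rewrite in_fsetI !in_fset_sep in_circle [RHS]andbACA andbb.
congr (_ && _); apply/andP/andP.
  by case=> /= px py; split; rewrite !rpredD // dvdz_mull.
case: w wE {cwE} => a b wE.
(* Otherwise p would divide a as well, and p^2 would divide the norm p. *)
have b0 : ~~ (p %| b)%Z.
  apply/negP => pb; have : (p %| enorm (a, b))%Z by rewrite wE.
  move: (pb); rewrite !(dvdz_pcharf chp) enorm_Fp => /eqP->.
  rewrite mulr0 expr0n !addr0 sqrf_eq0 -(dvdz_pcharf chp) => /dvdzP[c cE].
  case/dvdzP: pb wE => d -> ; rewrite cE /enorm /= => H.
  have p_gt1 := prime_gt1 p_pr; have p0 : p%:Z != 0 by lia.
  have : p%:Z * (c ^+ 2 + c * d + d ^+ 2) = 1.
    by apply: (mulfI p0); rewrite mulr1 -[RHS]H; ring.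
  by move: (_ + _ + _) => q; nia.
have : (p %| enorm (a, b))%Z by rewrite wE.
have n3 : (p %| 3)%N = false.
  by apply/negP; rewrite dvdn_prime2 // => /eqP pE3; rewrite pE3 in p3.
move: b0 n3; rewrite /emul /econj /= !(dvdz_pcharf chp) (dvdn_pcharf chp) enorm_Fp.
rewrite !rmorphD !rmorphM /= rmorphD rmorphN /=.
move: (a%:~R) (b%:~R) (x%:~R) (y%:~R) => {wE}a {}b {}x {}y b0 n3 /eqP ab [/eqP e1 /eqP e2].
have y0 : y = 0.
  (* The two conditions add up to (2a + b) y = 0, and (2a + b)^2 = 4 (a^2 + ab + b^2) - 3 b^2. *)
  have : - 3 * b ^+ 2 * y = 0.
    transitivity ((2 * a + b) * ((a + b) * y + - b * x + - b * y + (a * y + b * x + b * y))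
      - 4 * (a ^+ 2 + a * b + b ^+ 2) * y); first by ring.
    by rewrite e1 e2 ab; ring.
  by move/eqP; rewrite !mulf_eq0 oppr_eq0 n3 (negPf b0) /= => /eqP.
split; last by rewrite y0.
by move/eqP: e2; rewrite y0 !mulr0 add0r addr0 mulf_eq0 (negPf b0).
Qed.

(** * Divisor sums of the character modulo 3 *)

Definition chi (n : nat) : int :=
  if (n %% 3 == 1)%N then 1 else if (n %% 3 == 2)%N then -1 else 0.

Lemma chiM m n : chi (m * n) = chi m * chi n.
Proof.
rewrite /chi -modnMm.
have : (m %% 3 < 3)%N by rewrite ltn_mod.
have : (n %% 3 < 3)%N by rewrite ltn_mod.
by case: (m %% 3)%N => [|[|[|?]]] //; case: (n %% 3)%N => [|[|[|?]]].
Qed.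

Lemma card_circle_rec p m : prime p -> #|` circle (p * m)|%:Z =
  (1 + chi p) * #|` circle m|%:Z
  - chi p * (if (p %| m)%N then #|` circle (m %/ p)| else 0%N)%:Z.
Proof.
move=> p_pr; rewrite /chi; case: eqP => [p1|p1].
  by have := card_circle_split m p_pr p1; lia.
case: eqP => [p2|p2].
  by have := card_circle_inert m p_pr p2; lia.
have : (3 %| p)%N by lia.
by rewrite dvdn_prime2 // => /eqP <-; rewrite card_circle_ramified; lia.
Qed.

(* The divisor [k] here is complementary to the argument of [chi]. *)
Definition chi_sum (m : nat) : int := \sum_(k <- divisors m) chi (m %/ k).

(** Divisors k of p m that divide m contribute chi(p) times the sum for m. The others are k = p j
    with j | m and p j not dividing m; their sum is that for m minus the terms with p j | m, that
    is, j | m / p. *)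
Lemma chi_sum_rec p m : prime p -> (0 < m)%N -> chi_sum (p * m) =
  (1 + chi p) * chi_sum m
  - chi p * (if (p %| m)%N then chi_sum (m %/ p) else 0).
Proof.
move=> p_pr m0; have p0 := prime_gt0 p_pr.
have pm0 : (0 < p * m)%N by rewrite muln_gt0 p0.
have pI : injective (muln p) by move=> i j /eqP; rewrite eqn_pmul2l // => /eqP.
rewrite {1}/chi_sum (bigID (dvdn ^~ m)) /=.
have -> : \sum_(k <- divisors (p * m) | (k %| m)%N) chi (p * m %/ k) =
    chi p * chi_sum m.
  rewrite /chi_sum mulr_sumr -big_filter (perm_big (divisors m)) /=.
    by rewrite !big_seq; apply: eq_bigr => k; rewrite -dvdn_divisors // => km;
      rewrite -muln_divA // chiM.
  apply: uniq_perm; rewrite ?filter_uniq ?divisors_uniq // => k.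
  rewrite mem_filter -!dvdn_divisors // andb_idr // => km.
  exact: dvdn_mull.
have -> : \sum_(k <- divisors (p * m) | ~~ (k %| m)%N) chi (p * m %/ k) =
    \sum_(k <- divisors m | ~~ (p * k %| m)%N) chi (m %/ k).
  rewrite -big_filter (perm_big [seq (p * k)%N | k <- divisors m & ~~ (p * k %| m)%N]).
    by rewrite big_map big_filter; apply: eq_bigr => k _; rewrite divnMl.
  apply: uniq_perm; rewrite ?filter_uniq ?(map_inj_uniq pI) ?filter_uniq ?divisors_uniq //.
  move=> k; rewrite mem_filter -dvdn_divisors //.
  apply/andP/mapP => [[kNm kpm]|[j]]; last first.
    by rewrite mem_filter -dvdn_divisors // => /andP[? ?] ->; rewrite dvdn_pmul2l.
  have /dvdnP[j jE] : (p %| k)%N.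
    apply: contraR kNm; rewrite -prime_coprime // coprime_sym => cop.
    by rewrite -(Gauss_dvdr _ cop).
  exists j; last by rewrite mulnC.
  rewrite mem_filter -dvdn_divisors // mulnC -jE kNm /=.
  by rewrite -(dvdn_pmul2l p0) mulnC -jE.
have -> : \sum_(k <- divisors m | ~~ (p * k %| m)%N) chi (m %/ k) =
    chi_sum m - \sum_(k <- divisors m | (p * k %| m)%N) chi (m %/ k).
  by rewrite /chi_sum [X in X - _](bigID (fun k => p * k %| m)%N) /= [RHS]addrC addKr.
suff -> : \sum_(k <- divisors m | (p * k %| m)%N) chi (m %/ k) =
    chi p * (if (p %| m)%N then chi_sum (m %/ p) else 0) by ring.
case: ifPn => [/dvdnP[m' mE]|pNm]; last first.
  rewrite mulr0 big1_seq // => k /andP[pkm _].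
  by case/negP: pNm; apply: dvdn_trans pkm; apply: dvdn_mulr.
have m'0 : (0 < m')%N by move: m0; rewrite mE muln_gt0 => /andP[].
rewrite mE mulnK // /chi_sum mulr_sumr -big_filter (perm_big (divisors m')) /=.
  rewrite !big_seq; apply: eq_bigr => k; rewrite -dvdn_divisors // => km.
  by rewrite mulnC -muln_divA // chiM.
apply: uniq_perm; rewrite ?filter_uniq ?divisors_uniq // => k.
rewrite mem_filter -!dvdn_divisors -?mE // mE.
rewrite [(m' * p)%N]mulnC dvdn_pmul2l // andb_idr // => km.
exact: dvdn_mull.
Qed.

(** Both sides satisfy the same recurrence; strong induction removes the least prime factor, and m =
    1 counts the units. *)
Lemma card_circle m : (0 < m)%N -> #|` circle m|%:Z = 6 * chi_sum m.
Proof.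
elim/ltn_ind: m => m IHm m0; have [m1|m1] := leqP m 1.
  have -> : m = 1%N by lia.
  by rewrite card_circle1 /chi_sum /divisors /= big_cons big_nil.
have p_pr := pdiv_prime m1; have p_gt1 := prime_gt1 p_pr.
have /dvdnP[k mE] := pdiv_dvd m; move: (pdiv m) p_pr p_gt1 mE => p p_pr p_gt1 mE.
have k0 : (0 < k)%N by move: m0; rewrite mE muln_gt0 => /andP[].
rewrite mE mulnC card_circle_rec // chi_sum_rec // IHm //; last by nia.
case: ifP => [/dvdnP[j jE]|_]; last by ring.
have j0 : (0 < j)%N by move: k0; rewrite jE muln_gt0 => /andP[].
rewrite jE mulnK ?(ltnW p_gt1) // IHm //; first by ring.
by nia.
Qed.

(** * Summation over the norms and the floor count *)

(** From n to n + 1 the quotient by k changes only if k | n + 1, and then grows by 1; the indicator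
    of residue 1 changes by [chi] of the new quotient. *)
Lemma sum_chi_sum n : \sum_(1 <= m < n.+1) chi_sum m =
  \sum_(1 <= k < n.+1) ((n %/ k) %% 3 == 1)%N%:Z.
Proof.
elim: n => [|n IHn]; first by rewrite !big_geq.
rewrite big_nat_recr //= IHn.
(* The added term k = n + 1 vanishes, its quotient being 0. *)
have -> : \sum_(1 <= k < n.+1) ((n %/ k) %% 3 == 1)%N%:Z =
    \sum_(1 <= k < n.+2) ((n %/ k) %% 3 == 1)%N%:Z.
  by rewrite [RHS]big_nat_recr //= divn_small // addr0.
have -> : chi_sum n.+1 =
    \sum_(1 <= k < n.+2) if (k %| n.+1)%N then chi (n.+1 %/ k) else 0.
  rewrite -big_mkcond /= -big_filter; apply: perm_big.
  apply: uniq_perm; rewrite ?filter_uniq ?iota_uniq ?divisors_uniq // => k.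
  rewrite mem_filter -dvdn_divisors // mem_index_iota andb_idr // => kn.
  by rewrite (dvdn_gt0 _ kn) //= ltnS dvdn_leq.
rewrite -big_split /=; apply: eq_big_nat => k /andP[k0 _].
rewrite divnS // /chi; case: (k %| _)%N => /=; last by rewrite addr0.
by do !case: eqP => //; lia.
Qed.

Lemma floor_div_nat (R : realType) (n k : nat) : (0 < k)%N ->
  Num.floor (n%:R / k%:R : R) = (n %/ k)%N.
Proof.
move=> k0; have k0R : 0 < k%:R :> R by rewrite ltr0n.
apply: floor_def; rewrite ler_pdivlMr // ltr_pdivrMr //.
rewrite -PoszD -!pmulrn -!natrM ler_nat ltr_nat addn1.
by rewrite leq_divM ltn_ceil.
Qed.

Lemma floor_residue_countE (R : realType) (n : nat) :
  floor_residue_count n (0 : R) (0 : R) 1%Z 3 =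
  (\sum_(1 <= k < n.+1) ((n %/ k) %% 3 == 1))%N.
Proof.
pose s := [seq k <- index_iota 1 n.+1 | (n %/ k) %% 3 == 1]%N.
transitivity #|` Posz @` [fset k in s]|; last first.
  rewrite cardfs_imfset; last by move=> i j [].
  rewrite card_fseq undup_id ?filter_uniq ?iota_uniq //.
  by rewrite size_filter -sum1_count big_mkcond /=; apply: eq_bigr => k _; case: eqP.
rewrite /floor_residue_count; congr (#|` _|).
rewrite -[RHS]set_fsetK; congr fset_set; apply/seteqP; split => z /=.
  case; case: z => // k kn; rewrite subr0 addr0 floor_div_nat; last by lia.
  move=> kE; apply/mem_imfsetP; exists k => //.
  rewrite in_fset mem_filter mem_index_iota; lia.
case/mem_imfsetP => k; rewrite in_fset mem_filter mem_index_iota => H ->.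
by split; [lia | rewrite subr0 addr0 floor_div_nat; lia].
Qed.

Theorem corollary5p5 (R : realType) (n : nat) (n_gt0 : (0 < n)%N) :
  ellipse_count n = (6 * floor_residue_count n (0%R : R) (0%R : R) 1%Z 3 + 1)%N.
Proof.
rewrite ellipse_countE card_ball floor_residue_countE; congr (_ + 1)%N.
apply/eqP; rewrite -eqz_nat PoszM !(big_morph Posz PoszD (erefl _)).
rewrite -sum_chi_sum mulr_sumr; apply/eqP; apply: eq_big_nat => m /andP[m0 _].
exact: card_circle.
Qed.
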